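(* Let $A \in \mathbb{R}^{3 \times 3}$. If $A$ is an $\mathbf{E_{0_2}}$-matrix (resp., an $\mathbf{E_2}$-matrix), then the following hold: (a) $A$ is a $\mathbf{Z}$-matrix and has the form $$A = \begin{bmatrix} a & -b & -c \\ -d & e & -f \\ -g & -h & i \end{bmatrix},$$ where $a, e, i \geq 0$ (resp., $a, e, i > 0$) and $b, c, d, f, g, h > 0$. (b) All principal minors of $A$ of order $2$ are negative (resp., nonpositive).
   Context: All matrices are real. A matrix $M \in \mathbb{R}^{m\times m}$ is semimonotone if for every $0 \neq x \geq 0$ (entrywise) there is an index $i$ with $x_i > 0$ and $(Mx)_i \geq 0$; it is strictly semimonotone if for every $0 \neq x \geq 0$ there is an index $i$ with $x_i>0$ and $(Mx)_i > 0$. For $0 \le k \le n$, a matrix $A \in \mathbb{R}^{n\times n}$ is an $\mathbf{E_{0_k}}$-matrix (semimonotone of exact order $k$) if every principal submatrix of $A$ of order $n-k$ is semimonotone, but no principal submatrix of $A$ of order $r$ with $n-k < r \leq n$ is semimonotone. It is an $\mathbf{E_k}$-matrix (strictly semimonotone of exact order $k$) if the same holds with ''strictly semimonotone'' in place of ''semimonotone''. Thus for $n=3$, $k=2$: all $1\times 1$ principal submatrices are (strictly) semimonotone and no principal submatrix of order $2$ or $3$ is. A $\mathbf{Z}$-matrix is a real square matrix whose off-diagonal entries are all nonpositive. A principal minor is the determinant of a principal submatrix (same row and column index set). *)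

(* Defs.v *)
From HB Require Import structures.
From mathcomp Require Import all_boot all_order all_algebra.
From mathcomp Require Import reals.
Set Implicit Arguments.
Unset Strict Implicit.
Unset Printing Implicit Defensive.
Import Order.TTheory GRing.Theory Num.Theory.
Local Open Scope ring_scope.

Section Semimonotone.
Variable R : realType.

Definition semimonotone (m : nat) (M : 'M[R]_m) : Prop :=
  forall x : 'cV[R]_m, x != 0 -> (forall i, 0 <= x i 0) ->
    exists i, 0 < x i 0 /\ 0 <= (M *m x) i 0.

Definition strictly_semimonotone (m : nat) (M : 'M[R]_m) : Prop :=
  forall x : 'cV[R]_m, x != 0 -> (forall i, 0 <= x i 0) ->
    exists i, 0 < x i 0 /\ 0 < (M *m x) i 0.

(* [enum_val] lists the elements of S in increasing order. *)
Definition principal_submx (n : nat) (A : 'M[R]_n) (S : {set 'I_n}) :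
    'M[R]_#|S| :=
  mxsub (fun i : 'I_#|S| => enum_val i) (fun j : 'I_#|S| => enum_val j) A.

Definition exact_order (P : forall m : nat, 'M[R]_m -> Prop)
    (n k : nat) (A : 'M[R]_n) : Prop :=
  [/\ (k <= n)%N,
      forall S : {set 'I_n}, #|S| = (n - k)%N -> P #|S| (principal_submx A S)
    & forall S : {set 'I_n}, (n - k < #|S| <= n)%N ->
        ~ P #|S| (principal_submx A S)].

Definition E0_matrix (n k : nat) (A : 'M[R]_n) : Prop :=
  exact_order semimonotone k A.

Definition E_matrix (n k : nat) (A : 'M[R]_n) : Prop :=
  exact_order strictly_semimonotone k A.

Definition Z_matrix (n : nat) (A : 'M[R]_n) : Prop :=
  forall i j : 'I_n, i != j -> A i j <= 0.

Definition mx_of_rows (m n : nat) (s : seq (seq R)) : 'M[R]_(m, n) :=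
  \matrix_(i < m, j < n) nth 0 (nth [::] s i) j.

End Semimonotone.

(* Main.v *)
Require Import Defs.
From HB Require Import structures.
From mathcomp Require Import all_boot all_order all_algebra.
From mathcomp Require Import reals boolp lra.
Set Implicit Arguments.
Unset Strict Implicit.
Unset Printing Implicit Defensive.
Import Order.TTheory GRing.Theory Num.Theory.
Local Open Scope ring_scope.

(* If the diagonal is nonnegative (positive), a vector violating (strict) semimonotonicity
   of a 2x2 matrix [[p, q], [r, s]] must have both entries x, y positive, with
   p x + q y and r x + s y negative (nonpositive).  Hence q, r < 0, and
   multiplying p x < - q y by s y < - r x gives p s < q r.  Applied to each
   principal submatrix of order 2, this gives all the claims. *)

Section SemimonotoneIf.
Variable R : realType.

(* [large = true] is semimonotonicity and [large = false] its strict version,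
   both up to conversion; this treats the two halves of the theorem at once. *)
Definition semimonotone_if (large : bool) (m : nat) (M : 'M[R]_m) : Prop :=
  forall x : 'cV[R]_m, x != 0 -> (forall i, 0 <= x i 0) ->
    exists i, 0 < x i 0 /\ 0 < (M *m x) i 0 ?<= if large.

(** Test on the basis vector [delta_mx k 0]: its only positive entry is at [k], and there the
    product with [M] equals [M k k]. *)
Lemma semimonotone_if_diag large m (M : 'M[R]_m) (k : 'I_m) :
  semimonotone_if large M -> 0 < M k k ?<= if large.
Proof.
move=> /(_ (delta_mx k 0)) [||i []].
- by apply/eqP => /matrixP/(_ k 0)/eqP; rewrite !mxE !eqxx oner_eq0.
- by move=> i; rewrite mxE ler0n.
- rewrite -colE !mxE andbT; case: (i =P k) => [-> //|_].
  by rewrite ltxx.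
Qed.

(** Negating a comparison with 0 swaps strict and large, hence the flag [~~ large]. *)
Lemma not_semimonotone_if_witness large m (M : 'M[R]_m) :
  ~ semimonotone_if large M ->
  exists x : 'cV[R]_m, [/\ x != 0, forall i, 0 <= x i 0
    & forall i, 0 < x i 0 -> (M *m x) i 0 < 0 ?<= if ~~ large].
Proof.
move=> /existsNP[x /not_implyP[x0 /not_implyP[xge0 /forallNP xM]]].
exists x; split=> // i xi; rewrite lteifNE.
by apply/negP => Mxi; apply: (xM i).
Qed.

Lemma semimonotone_obstruction22 large (p q r s x y : R) :
  0 < p ?<= if large -> 0 < s ?<= if large ->
  0 <= x -> 0 <= y -> (x != 0) || (y != 0) ->
  (0 < x -> p * x + q * y < 0 ?<= if ~~ large) ->
  (0 < y -> r * x + s * y < 0 ?<= if ~~ large) ->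
  [/\ q < 0, r < 0 & p * s - q * r < 0 ?<= if ~~ large].
Proof.
rewrite !le_eqVlt => hp hs /predU1P[<-|x0] /predU1P[<-|y0];
  rewrite ?eqxx //.
(* If one coordinate vanishes, the condition at the other bounds [s * y] or [p * x] from above,
   against the sign of the diagonal entry. *)
- move=> _ _ /(_ y0); rewrite mulr0 add0r => hsy.
  by case: large hp hs hsy => /= hp hs hsy; nra.
- move=> _ /(_ x0) + _; rewrite mulr0 addr0 => hpx.
  by case: large hp hs hpx => /= hp hs hpx; nra.
move=> _ /(_ x0) h1 /(_ y0) h2.
have hxy := mulr_gt0 x0 y0.
case: large hp hs h1 h2 => /= hp hs h1 h2.
  have q0 : q < 0 by nra.
  have r0 : r < 0 by nra.
  split=> //.
  (* Since [x * y] is positive, it suffices to find the sign of [(p * s - q * r) * (x * y)]. *)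
  rewrite -(pmulr_llt0 _ hxy).
  have : (p * x) * (s * y) < (- q * y) * (- r * x) by apply: ltr_pM; nra.
  by nra.
(* Here [p] and [s] are positive, so the large inequalities still force [q] and [r] to be strictly
   negative. *)
have q0 : q < 0 by nra.
have r0 : r < 0 by nra.
split=> //.
rewrite -(pmulr_lle0 _ hxy).
have : (p * x) * (s * y) <= (- q * y) * (- r * x) by apply: ler_pM; nra.
by nra.
Qed.

Lemma det_mx22 (M : 'M[R]_2) : \det M = M 0 0 * M 1 1 - M 0 1 * M 1 0.
Proof.
rewrite (expand_det_row _ 0) big_ord_recl big_ord1 /cofactor !det_mx11 !mxE /=.
rewrite expr0 mul1r expr1 mulN1r mulrN.
by congr (_ * M _ _ - M _ _ * M _ _); apply: val_inj.
Qed.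

(** The order is a variable with an equation because a principal submatrix has order [#|S|], which
    is only provably equal to 2. *)
Lemma not_semimonotone_if_order2 large m (M : 'M[R]_m) : m = 2%N ->
  (forall k, 0 < M k k ?<= if large) -> ~ semimonotone_if large M ->
  (forall k l, k != l -> M k l < 0) /\ \det M < 0 ?<= if ~~ large.
Proof.
move=> m2; subst m => diag /not_semimonotone_if_witness[x [x_neq0 x_ge0 xM]].
have ord2 (i : 'I_2) : i = 0 \/ i = 1.
  by case: i => [[|[|//]]] ?; [left | right]; apply: val_inj.
have x01 : (x 0 0 != 0) || (x 1 0 != 0).
  rewrite -negb_and; apply: contra x_neq0 => /andP[/eqP x0 /eqP x1].
  apply/eqP/colP => i; rewrite mxE.
  by case: (ord2 i) => ->.
have mulE i : (M *m x) i 0 = M i 0 * x 0 0 + M i 1 * x 1 0.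
  by rewrite mxE big_ord_recl big_ord1; congr (_ + M i _ * x _ 0); apply: val_inj.
have := xM 1; have := xM 0; rewrite !mulE => M0 M1.
have [q0 r0 detM] := semimonotone_obstruction22 (diag 0) (diag 1)
  (x_ge0 0) (x_ge0 1) x01 M0 M1.
split; last by rewrite det_mx22.
by move=> k l; case: (ord2 k) => ->; case: (ord2 l) => ->.
Qed.

Lemma exact_order2_semimonotone_if large (A : 'M[R]_3) :
  exact_order (semimonotone_if large) 2 A ->
  [/\ forall i, 0 < A i i ?<= if large,
      forall i j, i != j -> A i j < 0
    & forall S : {set 'I_3}, #|S| = 2%N ->
        \det (principal_submx A S) < 0 ?<= if ~~ large].
Proof.
move=> [_ semi1 nsemi].
have diag i : 0 < A i i ?<= if large.
  (* The principal submatrix on [[set i]] has order 1 = 3 - 2, and its single entry is [A i i]. *)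
  have /semi1/semimonotone_if_diag := cards1 i.
  move=> /(_ (enum_rank_in (set11 i) i)).
  by rewrite mxE enum_rankK_in ?set11.
have order2 (S : {set 'I_3}) (S2 : #|S| = 2%N) :=
  @not_semimonotone_if_order2 large _ (principal_submx A S) S2.
have sub2 (S : {set 'I_3}) : #|S| = 2%N ->
    (forall k l, k != l -> principal_submx A S k l < 0) /\
    \det (principal_submx A S) < 0 ?<= if ~~ large.
  move=> S2; apply: order2 => // [k|]; first by rewrite mxE.
  by apply: nsemi; rewrite S2.
split=> // [i j ij|S /sub2[]//].
(* [A i j] is the entry of the submatrix on [[set i; j]] at the ranks of [i] and [j], which differ
   since [enum_val] maps them back to [i] and [j]. *)
have S2 : #|[set i; j]| = 2%N by rewrite cards2 ij.
have iS := set21 i j; have jS := set22 i j.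
have [+ _] := sub2 _ S2.
move=> /(_ (enum_rank_in iS i) (enum_rank_in iS j)).
rewrite mxE !enum_rankK_in //; apply.
apply: contra ij => /eqP/(congr1 enum_val).
by rewrite !enum_rankK_in // => ->.
Qed.

Lemma mx_of_rows33 (A : 'M[R]_3) :
  A = mx_of_rows 3 3 [:: [:: A 0 0; A 0 1; A 0 2%:R];
                         [:: A 1 0; A 1 1; A 1 2%:R];
                         [:: A 2%:R 0; A 2%:R 1; A 2%:R 2%:R]].
Proof.
by apply/matrixP => -[[|[|[|//]]] ?] [[|[|[|//]]] ?]; rewrite mxE /=;
  congr (A _ _); apply: val_inj.
Qed.

End SemimonotoneIf.

Theorem theorem3p3 (R : realType) (A : 'M[R]_3) :
  (E0_matrix 2 A ->
     (Z_matrix A /\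
      exists a b c d e f g h i : R,
        [/\ A = mx_of_rows 3 3 [:: [::   a; - b; - c];
                                   [:: - d;   e; - f];
                                   [:: - g; - h;   i]],
            [/\ 0 <= a, 0 <= e & 0 <= i]
          & [/\ 0 < b, 0 < c & 0 < d] /\ [/\ 0 < f, 0 < g & 0 < h]]) /\
     (forall S : {set 'I_3}, #|S| = 2%N -> \det (principal_submx A S) < 0))
  /\
  (E_matrix 2 A ->
     (Z_matrix A /\
      exists a b c d e f g h i : R,
        [/\ A = mx_of_rows 3 3 [:: [::   a; - b; - c];
                                   [:: - d;   e; - f];
                                   [:: - g; - h;   i]],
            [/\ 0 < a, 0 < e & 0 < i]
          & [/\ 0 < b, 0 < c & 0 < d] /\ [/\ 0 < f, 0 < g & 0 < h]]) /\
     (forall S : {set 'I_3}, #|S| = 2%N -> \det (principal_submx A S) <= 0)).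
Proof.
suff form large : exact_order (semimonotone_if large) 2 A ->
  (Z_matrix A /\
   exists a b c d e f g h i : R,
     [/\ A = mx_of_rows 3 3 [:: [::   a; - b; - c];
                                [:: - d;   e; - f];
                                [:: - g; - h;   i]],
         [/\ 0 < a ?<= if large, 0 < e ?<= if large & 0 < i ?<= if large]
       & [/\ 0 < b, 0 < c & 0 < d] /\ [/\ 0 < f, 0 < g & 0 < h]]) /\
  (forall S : {set 'I_3}, #|S| = 2%N ->
     \det (principal_submx A S) < 0 ?<= if ~~ large).
  (* For each value of [large] the conditional comparisons reduce to plain ones, so both halves hold
     by conversion. *)
  by split; [apply: (form true) | apply: (form false)].
move=> /exact_order2_semimonotone_if[diag off minors]; split=> //.
split; first by move=> i j /off/ltW.
exists (A 0 0), (- A 0 1), (- A 0 2%:R), (- A 1 0), (A 1 1), (- A 1 2%:R),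
  (- A 2%:R 0), (- A 2%:R 1), (A 2%:R 2%:R).
by rewrite !opprK !oppr_gt0 -mx_of_rows33; split=> //; split; split=> //;
  apply: off.
Qed.
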